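(* Let $k\ge 1$ and $l\ge 2$ be integers, let $n=l^{k}$, and let $p_X$ be an arbitrary probability distribution on $\mathbb{Z}_{l^k}=\{0,1,\ldots,l^k-1\}$. Let the messages $x_1,x_2,\ldots$ be i.i.d. with distribution $p_X$, and let them be written one after another, with the self-randomized modulation code, into a block of $n$ cells with $q$ levels each, starting from the all-zero cell state. Then, with probability tending to $1$ as $q\to\infty$ (with $k$, $l$, $p_X$ fixed), at least $n(q-q^{2/3})$ rewrites are performed before a block erasure is required. Therefore the self-randomized modulation code is asymptotically optimal for random inputs as $q\to\infty$, i.e., with probability tending to $1$ it achieves at least $n(q-o(q))$ rewrites before an erasure is required.
   Context: Memory model. A block consists of $n$ cells; at time $t$ cell $i$ ($0\le i\le n-1$) has charge level $s_t(i)\in\{0,1,\ldots,q-1\}$, and $\bar s_t=(s_t(0),\ldots,s_t(n-1))$ is the cell state. Charge levels can only be increased by a rewrite. A block erasure (resetting all levels to $0$) is required as soon as some cell level would have to be increased beyond the maximum value $q-1$. At each time $t=1,2,\ldots$ a new message $x_t\in\mathbb{Z}_{l^k}$ is to be stored; the encoder computes $\bar s_t$ from $\bar s_{t-1}$ and $x_t$, and the decoder recovers $x_t$ from $\bar s_t$ alone. Storing one message is one rewrite; a message equal to the currently stored one is also counted as a rewrite. Self-randomized modulation code. It uses $n=l^k$ cells, with initial state $\bar s_0=(0,\ldots,0)$. Decoder: given $\bar s_t$, compute $r_t=\|\bar s_t\|_1=\sum_{i=0}^{n-1}s_t(i)$ and $S_t=\sum_{i=1}^{n-1} i\,s_t(i)$,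 and output $\hat x_t = S_t-\frac{r_t(r_t+1)}{2} \bmod l^k$. Encoder: given $\bar s_{t-1}$ and $x_t$, compute $r_{t-1}$ and $\hat x_{t-1}$ from $\bar s_{t-1}$ as in the decoder. If $\hat x_{t-1}=x_t$, leave the state unchanged ($\bar s_t=\bar s_{t-1}$). Otherwise compute $\Delta x_t=x_t-\hat x_{t-1}\bmod l^k$ and $w_t=\Delta x_t+r_{t-1}+1 \bmod l^k$, and increase the charge level of cell $w_t$ by $1$ (all other cells unchanged). *)

(* Defs.v *)
From HB Require Import structures.
From mathcomp Require Import all_boot all_order all_algebra.
From mathcomp Require Import finmap all_classical all_reals all_analysis.
Set Implicit Arguments.
Unset Strict Implicit.
Unset Printing Implicit Defensive.
Import Order.TTheory GRing.Theory Num.Theory.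
Import numFieldNormedType.Exports.
Local Open Scope classical_set_scope.
Local Open Scope ring_scope.

HB.instance Definition _ n := isPointed.Build 'I_n.+1 ord0.
HB.instance Definition _ n := @isMeasurable.Build default_measure_display
  'I_n.+1 discrete_measurable discrete_measurable0
  discrete_measurableC discrete_measurableU.

(* Cells and messages are both indexed by the ring 'Z_n, which is the integers
   mod n only for n > 1.  Charge levels are plain naturals; the bound q on them
   is enforced by [rewrite_block]. *)
Section Code.
Variable n : nat.

Definition cell_state := {ffun 'Z_n -> nat}.

Definition total_charge (s : cell_state) : nat := (\sum_(i : 'Z_n) s i)%N.

Definition weighted_charge (s : cell_state) : nat :=
  (\sum_(i : 'Z_n | 1 <= i) i * s i)%N.

(* The quotient by 2 is taken in nat, where it is exact, before reducing mod n:
   2 need not be invertible in 'Z_n. *)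
Definition self_randomized_decode (s : cell_state) : 'Z_n :=
  let r := total_charge s in
  (weighted_charge s)%:R - ((r * r.+1) %/ 2)%N%:R.

Definition self_randomized_encode (s : cell_state) (x : 'Z_n) : cell_state :=
  if self_randomized_decode s == x then s
  else
    let w := (x - self_randomized_decode s) + (total_charge s)%:R + 1 in
    [ffun i => if i == w then (s i).+1 else s i].

(* [None] means that the rewrite would push some cell beyond level q - 1, that
   is, that a block erasure is required. *)
Definition rewrite_block (enc : cell_state -> 'Z_n -> cell_state) (q : nat)
    (s : cell_state) (x : 'Z_n) : option cell_state :=
  let s' := enc s x in
  if [forall i, (s' i < q)%N] then Some s' else None.

(* State after writing the first t messages x 0, ..., x t.-1 into an erased
   block. *)
Fixpoint write_messages (enc : cell_state -> 'Z_n -> cell_state) (q : nat)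
    (x : nat -> 'Z_n) (t : nat) : option cell_state :=
  if t is t'.+1 then
    obind (fun s => rewrite_block enc q s (x t')) (write_messages enc q x t')
  else Some [ffun=> 0%N].

(* +oo when no erasure is ever required, e.g. for a constant message stream. *)
Definition rewrites_before_erasure (R : realType)
    (enc : cell_state -> 'Z_n -> cell_state) (q : nat) (x : nat -> 'Z_n)
    : \bar R :=
  ereal_sup [set t%:R%:E | t in [set t | isSome (write_messages enc q x t)]].

End Code.

Section RandomMessages.
Context {d d' : measure_display} {Omega : measurableType d}
  {T : measurableType d'} {R : realType} (P : probability Omega R).

Definition mutually_independent (X : nat -> {RV P >-> T}) :=
  forall (J : {fset nat}) (A : nat -> set T),
    (forall i, i \in J -> measurable (A i)) ->
    P (\bigcap_(i in [set` J]) (X i @^-1` A i)) =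
    (\prod_(i <- J) P (X i @^-1` A i))%E.

Definition iid (p : probability T R) (X : nat -> {RV P >-> T}) :=
  mutually_independent X /\
  forall i (A : set T), measurable A -> distribution P (X i) A = p A.

End RandomMessages.

(* [N q] is the random number of rewrites before an erasure in a block of n
   cells with q levels. *)
Definition with_high_probability_at_least d (Omega : measurableType d)
    (R : realType) (P : probability Omega R)
    (N : nat -> Omega -> \bar R) (b : nat -> R) :=
  P [set om | ((b q)%:E <= N q om)%E] @[q --> \oo] --> 1%E.

Definition asymptotically_optimal d (Omega : measurableType d)
    (R : realType) (P : probability Omega R) (n : nat)
    (N : nat -> Omega -> \bar R) :=
  exists f : nat -> R^o,
    f =o_\oo (fun q : nat => q%:R : R^o) /\
    with_high_probability_at_least P N (fun q => n%:R * (q%:R - f q)).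

(* Main.v *)
(* Let Y_t be the pair formed by the decoded message and the number of charge
   increments mod n after t rewrites; it is a Markov chain on Z_n x Z_n, and
   whether cell i is charged at step t depends only on Y_t and the new message.
   For each cell i, let mu = (1 - sum_a p(a)^2) / n.  The Poisson equation of
   this chain has a solution g with constant drift mu, whatever the support of
   p, so that Z_t = s_t(i) - mu t + g(Y_t) is a martingale with bounded
   increments and E Z_t^2 = O(t).  Since mu <= 1/n, at t = n(q - q^(2/3)) + O(1)
   the event s_t(i) >= q forces Z_t >= q^(2/3) / 2, which by Chebyshev has
   probability O(q / q^(4/3)) -> 0; a union bound over the n cells ends the
   proof.

   The chain may be reducible (p supported on two messages, n even), so the
   Poisson equation is solved by the Fredholm alternative: the equation for the
   hits of cell i has to be orthogonal to every signed stationary measure u.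
   Such a u has the form u(b, s) = p(b) h(b, s) with h(b, s + 1) = h(a, s) for
   a <> b in the support of p, and for such h the contributions of the changes
   a -> b and b -> a to the hits of cell i add up to a quantity that does not
   depend on i. *)
Require Import Defs.
From mathcomp Require Import all_boot all_order all_algebra.
From mathcomp Require Import all_classical all_reals all_analysis.
From mathcomp Require Import finmap ring lra.
Set Implicit Arguments.
Unset Strict Implicit.
Unset Printing Implicit Defensive.
Import Order.TTheory GRing.Theory Num.Theory.
Import numFieldNormedType.Exports.
Local Open Scope classical_set_scope.
Local Open Scope ring_scope.

(** The vector f lies in the row space of (1 - K)^T iff it is killed by the cokernel of that matrix,
    whose columns are exactly the u with uK = u. No positivity or stochasticity of K enters. *)
Lemma fredholm (F : fieldType) (T : finType) (K : T -> T -> F) (f : T -> F) :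
    (forall u : T -> F, (forall x, \sum_y u y * K y x = u x) ->
       \sum_y u y * f y = 0) ->
  exists g : T -> F, forall x, g x = \sum_y K x y * g y + f x.
Proof.
move=> fperp.
have sum_rank (G : 'I_#|T| -> F) : \sum_j G j = \sum_y G (enum_rank y).
  by rewrite (reindex (@enum_rank T)) //; apply/onW_bij/enum_rank_bij.
pose A := (1%:M - \matrix_(i, j) K (enum_val i) (enum_val j))^T : 'M[F]_#|T|.
pose v := \row_j f (enum_val j) : 'rV[F]_#|T|.
have sub_vA : (v <= A)%MS.
  rewrite submxE; apply/eqP; have := mulmx_coker A.
  move: (cokermx A) => C AC0; apply/rowP => j; rewrite !mxE.
  pose u x := C (enum_rank x) j.
  have stat_u x : \sum_y u y * K y x = u x.
    have /matrixP/(_ (enum_rank x) j) := AC0.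
    rewrite /A linearB /= trmx1 mulmxBl mul1mx !mxE => /subr0_eq ux.
    rewrite [RHS]ux sum_rank; apply: eq_bigr => y _.
    by rewrite !mxE !enum_rankK mulrC.
  rewrite -[RHS](fperp u stat_u) sum_rank.
  by apply: eq_bigr => y _; rewrite !mxE enum_rankK mulrC.
have /submxP[w vE] := sub_vA.
exists (fun x => w 0 (enum_rank x)) => x.
have /rowP/(_ (enum_rank x)) := vE.
rewrite /A linearB /= trmx1 mulmxBr mulmx1 !mxE enum_rankK => ->.
set S := \sum_(j < _) _; suff -> : S = \sum_y K x y * w 0 (enum_rank y).
  by rewrite addrCA subrr addr0.
rewrite /S sum_rank; apply: eq_bigr => y _.
by rewrite !mxE !enum_rankK mulrC.
Qed.

(** * The Poisson equation of the message chain *)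
Section Poisson.
Variables (R : realFieldType) (n : nat) (p : 'Z_n -> R).
Hypothesis p_ge0 : forall a, 0 <= p a.
Hypothesis p_sum : \sum_a p a = 1.

(* The sum of p(a) p(b) (h(b, s) - h(a, s - [b != a]))^2 over a, b and s is 0,
   because p times the uniform measure is stationary. *)
Lemma harmonic_constant (h : 'Z_n -> 'Z_n -> R) :
    (forall b s, h b s = \sum_a p a * h a (s - (b != a)%:R)) ->
  forall a b s, p a != 0 -> p b != 0 -> h b s = h a (s - (b != a)%:R).
Proof.
move=> hE a b s pa pb.
pose e b s a := p b * (p a * (h b s - h a (s - (b != a)%:R)) ^+ 2).
have e_ge0 b' s' a' : 0 <= e b' s' a'.
  by rewrite /e; do 2![apply: mulr_ge0 => //]; apply: sqr_ge0.
have e_sum : \sum_b \sum_s \sum_a e b s a = 0.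
  (* Expand the square: by harmonicity the cross term averages to -2 h(b, s)^2. *)
  have -> : \sum_b \sum_s \sum_a e b s a =
    \sum_b \sum_s (p b * \sum_a p a * h a (s - (b != a)%:R) ^+ 2 -
                   p b * h b s ^+ 2).
    apply: eq_bigr => b' _; apply: eq_bigr => s' _.
    rewrite -mulr_sumr -mulrBr; congr (_ * _).
    transitivity (\sum_a' (p a' * h a' (s' - (b' != a')%:R) ^+ 2
        + (p a' * h b' s' ^+ 2
           - 2 * h b' s' * (p a' * h a' (s' - (b' != a')%:R))))).
      by apply: eq_bigr => a' _; ring.
    rewrite big_split sumrB /= -mulr_sumr -hE -mulr_suml p_sum; ring.
  under eq_bigr do rewrite sumrB.
  rewrite sumrB; apply/eqP; rewrite subr_eq0; apply/eqP.
  (* Translating s removes the shift by [b != a]. *)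
  transitivity (\sum_b' \sum_a' p b' * (p a' * \sum_s' h a' s' ^+ 2)).
    apply: eq_bigr => b' _; rewrite -mulr_sumr -mulr_sumr exchange_big /=.
    congr (_ * _); apply: eq_bigr => a' _; rewrite -mulr_sumr; congr (_ * _).
    by rewrite [RHS](reindex_inj (addIr (- (b' != a')%:R))).
  under eq_bigr do rewrite -mulr_sumr.
  rewrite -mulr_suml p_sum mul1r.
  by apply: eq_bigr => a' _; rewrite mulr_sumr.
have es_ge0 b' s' : 0 <= \sum_a e b' s' a by rewrite sumr_ge0.
move/eqP: e_sum; rewrite psumr_eq0; last by move=> b' _; rewrite sumr_ge0.
move=> /allP/(_ b (mem_index_enum _)).
rewrite implyTb psumr_eq0 // => /allP/(_ s (mem_index_enum _)).
rewrite implyTb psumr_eq0 // => /allP/(_ a (mem_index_enum _)).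
by rewrite implyTb /e !mulf_eq0 (negbTE pa) (negbTE pb) orbb subr_eq0 => /eqP.
Qed.

Lemma harmonic_step (h : 'Z_n -> 'Z_n -> R) :
    (forall b s, h b s = \sum_a p a * h a (s - (b != a)%:R)) ->
  forall a b s, p a != 0 -> p b != 0 -> b != a -> h b (s + 1) = h a s.
Proof.
move=> hE a b s pa pb ba.
by rewrite (harmonic_constant hE _ pa pb) ba addrK.
Qed.

(** The changes a -> b -> a give h a period 2 in s, so h a s + h a (s + 1) is a constant. The two
    arguments on the left fall, modulo even shifts, on consecutive values of s. The right side is
    twice the total mass of the stationary measure p h. *)
Lemma harmonic_pair (h : 'Z_n -> 'Z_n -> R) :
    (forall b s, h b s = \sum_a p a * h a (s - (b != a)%:R)) ->
  forall a b c, p a != 0 -> p b != 0 -> b != a ->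
  #|'Z_n|%:R * (h a (c - (b - a)) + h b (c - (a - b))) =
    2 * \sum_a p a * \sum_s h a s.
Proof.
move=> hE a b c pa pb ba; have step := harmonic_step hE.
have haS s : h a (s + 1 + 1) = h a s.
  by rewrite (step b) ?(step a) // eq_sym.
have ha_even s m : h a (s + m%:R + m%:R) = h a s.
  elim: m => [|m IHm]; first by rewrite !addr0.
  by rewrite -[RHS]IHm -[RHS]haS -natr1; congr (h a _); ring.
have ha_cst s t : h a s + h a (s + 1) = h a t + h a (t + 1).
  have shift m : h a (t + m%:R) + h a (t + m%:R + 1) = h a t + h a (t + 1).
    elim: m => [|m <-]; first by rewrite addr0.
    by rewrite -natr1 addrA haS [LHS]addrC.
  by rewrite -(shift (s - t)) natr_Zp (addrC t) subrK.
(* One change turns h b into h a, and c - (a - b) differs from c - (b - a) by the even amount 2 (b -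
   a). *)
have -> : h b (c - (a - b)) = h a (c - (b - a) + 1).
  rewrite -[c - (a - b)](subrK 1) (step a) // -[LHS]haS.
  rewrite -[RHS](ha_even _ (b - a)).
  by rewrite natr_Zp; congr (h a _); ring.
(* All messages of the support have the same mass over s, since one change only translates s. *)
have -> : \sum_a p a * \sum_s h a s = \sum_s h a s.
  transitivity (\sum_a' p a' * \sum_s h a s); last first.
    by rewrite -mulr_suml p_sum mul1r.
  apply: eq_bigr => a' _; have [->|pa'] := eqVneq (p a') 0; rewrite ?mul0r //.
  have [-> //|aa'] := eqVneq a' a; congr (_ * _).
  rewrite (reindex_inj (addIr 1)) /=.
  by apply: eq_bigr => s _; rewrite (step a).
rewrite mulr_natl -sumr_const mulr_natl mulr2n.
rewrite [X in _ = _ + X](reindex_inj (addIr 1)) -big_split /=.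
by apply: eq_bigr => s _; rewrite (ha_cst _ s).
Qed.

(* Indicator that cell i is charged when message b is written while message a
   is stored, r being the number of increments so far mod n. *)
Definition hit (i a r b : 'Z_n) : R := ((b != a) && (b - a + r + 1 == i))%:R.

Definition hit_rate : R := (1 - \sum_a p a ^+ 2) / #|'Z_n|%:R.

Lemma poisson (i : 'Z_n) : exists g : 'Z_n -> 'Z_n -> R, forall a r,
  \sum_b p b * (hit i a r b + g b (r + (b != a)%:R)) = g a r + hit_rate.
Proof.
pose K (x y : 'Z_n * 'Z_n) := p y.1 * (y.2 == x.2 + (y.1 != x.1)%:R)%:R.
pose f (x : 'Z_n * 'Z_n) := \sum_b p b * hit i x.1 x.2 b - hit_rate.
have sum_pair (F : 'Z_n * 'Z_n -> R) : \sum_x F x = \sum_a \sum_s F (a, s).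
  by rewrite pair_big; apply: eq_bigr => -[].
have [|g gE] := @fredholm R _ K f; last first.
  exists (fun a r => g (a, r)) => a r; rewrite [g _]gE /f /= addrA subrK.
  under eq_bigr do rewrite mulrDr.
  rewrite big_split /= addrC sum_pair; congr (_ + _).
  apply: eq_bigr => b _; rewrite (bigD1 (r + (b != a)%:R)) //=.
  rewrite big1 ?addr0 ?/K /= ?eqxx ?mulr1 // => s /negPf ->.
  by rewrite mulr0 mul0r.
move=> u uE.
(* This density of u with respect to p is defined without dividing by p b, which may be 0. *)
pose h b s := \sum_a u (a, s - (b != a)%:R).
have uh b s : u (b, s) = p b * h b s.
  rewrite -uE sum_pair mulr_sumr; apply: eq_bigr => a _.
  rewrite (bigD1 (s - (b != a)%:R)) //= big1 ?addr0 /K /=.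
    by rewrite subrK eqxx mulr1 mulrC.
  move=> r rN; case: eqP => [sE|]; last by rewrite !mulr0.
  by rewrite sE addrK eqxx in rN.
have hE b s : h b s = \sum_a p a * h a (s - (b != a)%:R).
  by apply: eq_bigr => a _; rewrite -uh.
pose Z := \sum_a \sum_r u (a, r).
suff key : \sum_a \sum_r u (a, r) * \sum_b p b * hit i a r b = hit_rate * Z.
  rewrite sum_pair /f /=.
  under eq_bigr do under eq_bigr do rewrite mulrBr.
  under eq_bigr do rewrite sumrB -mulr_suml.
  by rewrite sumrB -mulr_suml -/Z key mulrC subrr.
have ZE : Z = \sum_a p a * \sum_r h a r.
  by apply: eq_bigr => a _; rewrite mulr_sumr; apply: eq_bigr => r _.
have LE : \sum_a \sum_r u (a, r) * \sum_b p b * hit i a r b =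
    \sum_a \sum_b p a * p b * ((b != a)%:R * h a (i - 1 - (b - a))).
  apply: eq_bigr => a _; under eq_bigr do rewrite mulr_sumr.
  rewrite exchange_big; apply: eq_bigr => b _.
  rewrite (bigD1 (i - 1 - (b - a))) //= big1 ?addr0 => [|r rN].
    rewrite uh /hit (_ : b - a + _ + 1 = i) ?eqxx ?andbT; last by ring.
    by ring.
  rewrite /hit; case: (b - a + r + 1 =P i) => [ri|_]; last first.
    by rewrite andbF !mulr0.
  by case/negP: rN; rewrite -ri; apply/eqP; ring.
have n0 : #|'Z_n|%:R != 0 :> R by rewrite pnatr_eq0 card_ord.
apply: (@mulIf _ (2 * #|'Z_n|%:R)); first by rewrite mulf_neq0 // pnatr_eq0.
transitivity (\sum_a \sum_b p a * p b * (b != a)%:R * (2 * Z)).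
  set L := LHS.
  (* Adding the transposed sum puts a -> b and b -> a side by side, as [harmonic_pair] requires. *)
  have -> : L = #|'Z_n|%:R *
      (\sum_a \sum_b p a * p b * ((b != a)%:R * h a (i - 1 - (b - a))) +
       \sum_b \sum_a p a * p b * ((b != a)%:R * h a (i - 1 - (b - a)))).
    by rewrite /L LE [X in _ * (_ + X)]exchange_big /=; ring.
  rewrite -big_split /= mulr_sumr; apply: eq_bigr => a _.
  rewrite -big_split /= mulr_sumr; apply: eq_bigr => b _.
  have [->|pa] := eqVneq (p a) 0; first by rewrite !(mul0r, mulr0) addr0 mulr0.
  have [->|pb] := eqVneq (p b) 0; first by rewrite !(mul0r, mulr0) addr0 mulr0.
  have [->|ba] := eqVneq b a; first by rewrite /= !(mul0r, mulr0) addr0 mulr0.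
  by rewrite /= ZE -(harmonic_pair hE (i - 1) pa pb ba); ring.
under eq_bigr do rewrite -mulr_suml.
rewrite -mulr_suml.
suff -> : \sum_a \sum_b p a * p b * (b != a)%:R = 1 - \sum_a p a ^+ 2.
  by rewrite /hit_rate; field.
rewrite -[X in _ = X - _]p_sum -sumrB; apply: eq_bigr => a _.
rewrite (bigD1 a) //= eqxx mulr0 add0r.
transitivity (p a * \sum_(b | b != a) p b).
  by rewrite mulr_sumr; apply: eq_bigr => b ->; rewrite mulr1.
have := p_sum; rewrite (bigD1 a) //= => /(canRL (addKr _)) ->.
by ring.
Qed.

End Poisson.

(** * The code *)
Section Encoder.
Variable n : nat.
Implicit Types (s : cell_state n) (x i : 'Z_n).

(** Both branches of the encoder merge into one Boolean increment, the one that [hit] describes. *)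
Lemma encode_cell s x i :
  self_randomized_encode s x i =
    (s i + ((x != self_randomized_decode s) &&
            (x - self_randomized_decode s + (total_charge s)%:R + 1 == i)%R))%N.
Proof.
rewrite /self_randomized_encode eq_sym; case: eqP => _; first by rewrite addn0.
by rewrite ffunE eq_sym; case: (_ == i); rewrite ?addn1 ?addn0.
Qed.

Lemma total_charge_encode s x :
  total_charge (self_randomized_encode s x) =
    (total_charge s + (x != self_randomized_decode s))%N.
Proof.
rewrite /total_charge (eq_bigr _ (fun i _ => encode_cell s x i)) big_split /=.
congr addn; case: (x != _) => /=; last by rewrite big1.
set w := (X in (\sum_i (X == i))%N).
by rewrite (bigD1 w) //= eqxx big1 // => i /negPf; rewrite eq_sym => ->.
Qed.

Lemma weighted_chargeE s :
  (weighted_charge s)%:R = \sum_(i : 'Z_n) i * (s i)%:R :> 'Z_n.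
Proof.
rewrite /weighted_charge natr_sum big_mkcond /=; apply: eq_bigr => i _.
rewrite natrM natr_Zp; case: ifP => // i0.
by rewrite (_ : i = 0) ?mul0r //; apply/val_inj/eqP; rewrite -leqn0 leqNgt i0.
Qed.

(** Charging cell w adds x - decode(s) + r + 1 to the weighted charge, while the triangular number
    of r grows by r + 1; the decoded value thus moves by x - decode(s). *)
Lemma decode_encode s x :
  self_randomized_decode (self_randomized_encode s x) = x.
Proof.
rewrite {1}/self_randomized_decode total_charge_encode weighted_chargeE.
under eq_bigr do rewrite encode_cell natrD mulrDr.
rewrite big_split /= -weighted_chargeE.
case: eqVneq => [->|xs] /=.
  by rewrite big1 ?addr0 ?addn0 // => i _; rewrite mulr0.
set w := x - _ + _ + 1.
rewrite (bigD1 w) //= eqxx mulr1 big1 ?addr0; last first.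
  by move=> i /negPf; rewrite eq_sym => ->; rewrite mulr0.
rewrite addn1 /w /self_randomized_decode; move: (total_charge s) => r.
have -> : (r.+1 * r.+2 %/ 2 = r * r.+1 %/ 2 + r.+1)%N.
  by rewrite [RHS]addnC -divnMDl // (mulnC r) -mulnDr.
by rewrite natrD -[r.+1]addn1 natrD; ring.
Qed.

End Encoder.

(** * Means over independent letters *)
Section Words.
Variables (R : realFieldType) (n : nat) (p : 'Z_n -> R).
Hypothesis p_ge0 : forall a, 0 <= p a.
Hypothesis p_sum : \sum_a p a = 1.

(* Mean of F over words of t independent letters of law p.  The recursion
   averages the last letter first, so that it displays the conditional
   expectation given the first t.-1 letters. *)
Fixpoint word_mean (t : nat) (F : seq 'Z_n -> R) : R :=
  if t is t'.+1 then word_mean t' (fun w => \sum_b p b * F (rcons w b))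
  else F [::].

Lemma le_word_mean t F G : (forall w, size w = t -> F w <= G w) ->
  word_mean t F <= word_mean t G.
Proof.
elim: t F G => [|t IH] F G FG /=; first exact: FG.
apply: IH => w wt; apply: ler_sum => b _; apply: ler_wpM2l => //.
by apply: FG; rewrite size_rcons wt.
Qed.

Lemma eq_word_mean t F G : F =1 G -> word_mean t F = word_mean t G.
Proof.
elim: t F G => [|t IH] F G FG /=; first exact: FG.
by apply: IH => w; apply: eq_bigr => b _; rewrite FG.
Qed.

Lemma word_meanZ t c F : word_mean t (fun w => c * F w) = c * word_mean t F.
Proof.
elim: t F => [|t IH] F //=; rewrite -IH; apply: eq_word_mean => w.
by rewrite mulr_sumr; apply: eq_bigr => b _; rewrite mulrCA.
Qed.

Lemma word_meanD t F G :
  word_mean t (fun w => F w + G w) = word_mean t F + word_mean t G.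
Proof.
elim: t F G => [|t IH] F G //=; rewrite -IH; apply: eq_word_mean => w.
by rewrite -big_split; apply: eq_bigr => b _; rewrite mulrDr.
Qed.

Lemma word_mean_sum (I : finType) t (F : I -> seq 'Z_n -> R) :
  word_mean t (fun w => \sum_i F i w) = \sum_i word_mean t (F i).
Proof.
elim: t F => [|t IH] F //=; rewrite -IH; apply: eq_word_mean => w.
by rewrite exchange_big; apply: eq_bigr => b _; rewrite mulr_sumr.
Qed.

Lemma word_mean_cst t c : word_mean t (fun=> c) = c.
Proof.
elim: t => //= t {2}<-; apply: eq_word_mean => w.
by rewrite -mulr_suml p_sum mul1r.
Qed.

(** The increments are orthogonal to the past, so each step adds at most C to the second moment. *)
Lemma word_mean_martingale (Z : seq 'Z_n -> R) (C : R) :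
    (forall w, \sum_b p b * Z (rcons w b) = Z w) ->
    (forall w b, (Z (rcons w b) - Z w) ^+ 2 <= C) ->
  forall t, word_mean t (fun w => Z w ^+ 2) <= Z [::] ^+ 2 + C * t%:R.
Proof.
move=> Zmart ZC; elim=> [|t IH]; first by rewrite mulr0 addr0.
rewrite -natr1 mulrDr mulr1 addrA; apply: le_trans (lerD IH (lexx C)).
rewrite -{1}(word_mean_cst t C) -word_meanD /=; apply: le_word_mean => w _.
have -> : \sum_b p b * Z (rcons w b) ^+ 2 =
    Z w ^+ 2 + \sum_b p b * (Z (rcons w b) - Z w) ^+ 2.
  transitivity (\sum_b (2 * Z w * (p b * Z (rcons w b)) - Z w ^+ 2 * p b
      + p b * (Z (rcons w b) - Z w) ^+ 2)).
    by apply: eq_bigr => b _; ring.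
  rewrite big_split sumrB /= -!mulr_sumr Zmart p_sum; ring.
rewrite lerD2l -[leRHS]mul1r -p_sum mulr_suml.
by apply: ler_sum => b _; apply: ler_wpM2l.
Qed.

(** Levels are unbounded here, so that the chain runs on every word; [write_messagesE] brings back
    the bound q. *)
Definition block_state (w : seq 'Z_n) : cell_state n :=
  foldl (@self_randomized_encode n) [ffun=> 0%N] w.

Lemma block_state_rcons w b :
  block_state (rcons w b) = self_randomized_encode (block_state w) b.
Proof. exact: foldl_rcons. Qed.

(** Chebyshev for the martingale of cell i: c is the margin left below q after the mean load t / n
    and the bound G on the corrector g. *)
Lemma cell_tail (i : 'Z_n) : exists C G : R, forall (t q : nat) (c : R),
  0 < c -> c + G + t%:R / #|'Z_n|%:R <= q%:R ->
  word_mean t (fun w => (q <= block_state w i)%:R) <= C * t.+1%:R / c ^+ 2.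
Proof.
have [g gE] := poisson p_ge0 p_sum i.
pose mu := hit_rate p.
pose Y w := self_randomized_decode (block_state w).
pose r w : 'Z_n := (total_charge (block_state w))%:R.
pose Z w := (block_state w i)%:R - mu * (size w)%:R + g (Y w) (r w).
pose D (a s b : 'Z_n) := hit R i a s b - mu + (g b (s + (b != a)%:R) - g a s).
have ZD w b : Z (rcons w b) - Z w = D (Y w) (r w) b.
  rewrite /Z /D /Y /r block_state_rcons decode_encode total_charge_encode.
  rewrite encode_cell size_rcons !natrD -natr1 /hit; ring.
have Zmart w : \sum_b p b * Z (rcons w b) = Z w.
  apply/eqP; rewrite -subr_eq0; apply/eqP.
  transitivity (\sum_b p b * (Z (rcons w b) - Z w)).
    under [RHS]eq_bigr do rewrite mulrBr.
    by rewrite sumrB -mulr_suml p_sum mul1r.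
  under eq_bigr do rewrite ZD.
  transitivity (\sum_b (
      p b * (hit R i (Y w) (r w) b + g b (r w + (b != Y w)%:R)) -
      p b * (mu + g (Y w) (r w)))).
    by apply: eq_bigr => b _; rewrite /D; ring.
  by rewrite sumrB gE -mulr_suml p_sum /mu; ring.
(* Increments depend on finitely many triples (a, s, b), so the sum of all their squares bounds each
   one. *)
pose C := \sum_a \sum_s \sum_b D a s b ^+ 2.
have DC a s b : D a s b ^+ 2 <= C.
  rewrite /C (bigD1 a) //= (bigD1 s) //= (bigD1 b) //= -!addrA lerDl.
  do ![apply: addr_ge0 || apply: sumr_ge0 => ? _]; exact: sqr_ge0.
have C0 : 0 <= C by apply: le_trans (DC 0 0 0); apply: sqr_ge0.
pose G := \sum_a \sum_s `|g a s|.
have gG a s : - G <= g a s.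
  rewrite lerNl (le_trans (ler_norm _)) // normrN /G.
  rewrite (bigD1 a) //= (bigD1 s) //= -addrA lerDl.
  by do ![apply: addr_ge0 || apply: sumr_ge0 => ? _].
have mu_le : mu <= #|'Z_n|%:R^-1.
  rewrite /mu /hit_rate -[leRHS]mul1r ler_wpM2r ?invr_ge0 ?ler0n //.
  by rewrite lerBlDr lerDl sumr_ge0 // => a _; apply: sqr_ge0.
(* The factor t + 1 absorbs the initial term, as Z [::] is a value of g and need not vanish. *)
exists (Z [::] ^+ 2 + C), G => t q c c0 cq.
have ZC w b : (Z (rcons w b) - Z w) ^+ 2 <= C by rewrite ZD.
have := word_mean_martingale Zmart ZC t.
have le_t : Z [::] ^+ 2 + C * t%:R <= (Z [::] ^+ 2 + C) * t.+1%:R.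
  rewrite -subr_ge0 -natr1.
  rewrite (_ : _ - _ = Z [::] ^+ 2 * t%:R + C); last by ring.
  by rewrite addr_ge0 // mulr_ge0 // sqr_ge0.
move=> /le_trans/(_ le_t).
rewrite -(ler_pM2r (_ : 0 < (c ^+ 2)^-1)) ?invr_gt0 ?exprn_gt0 //.
apply: le_trans; rewrite mulrC -word_meanZ; apply: le_word_mean => w wt.
case: leqP => qU /=; last by rewrite mulr_ge0 ?invr_ge0 ?sqr_ge0.
suff cZ : c <= Z w.
  rewrite mulrC ler_pdivlMr ?exprn_gt0 // mul1r.
  by rewrite ler_pXn2r // nnegrE ltW // (lt_le_trans c0).
have {}qU : q%:R <= (block_state w i)%:R :> R by rewrite ler_nat.
have := gG (Y w) (r w).
have : mu * t%:R <= t%:R / #|'Z_n|%:R by rewrite mulrC ler_wpM2l.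
by rewrite /Z wt; move: (g _ _) (mu * _) (t%:R / _) cq => y m u; lra.
Qed.

Lemma block_tail : exists K G : R, 0 <= K /\ forall (t q : nat) (c : R),
  0 < c -> c + G + t%:R / #|'Z_n|%:R <= q%:R ->
  1 - K * t.+1%:R / c ^+ 2 <=
    word_mean t (fun w => [forall i, (block_state w i < q)%N]%:R).
Proof.
have [C /fin_all_exists[G CG]] := fin_all_exists cell_tail.
(* Sums of absolute values serve all cells at once, the signs of C i and G i being unknown. *)
exists (\sum_i `|C i|), (\sum_i `|G i|).
split=> [|t q c c0 cq]; first exact: sumr_ge0.
apply: (@le_trans _ _ (word_mean t
    (fun w => 1 + -1 * \sum_i (q <= block_state w i)%:R))); last first.
  apply: le_word_mean => w _; case: forallP => [_|].
    by rewrite mulN1r gerBl sumr_ge0.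
  move=> /forallP; rewrite negb_forall => /existsP[i]; rewrite -leqNgt => qi.
  rewrite (bigD1 i) //= qi mulN1r opprD addrA subrr add0r oppr_le0.
  exact: sumr_ge0.
rewrite word_meanD word_mean_cst word_meanZ mulN1r lerD2l lerN2.
rewrite word_mean_sum -mulrA mulr_suml; apply: ler_sum => i _.
have /CG : c + G i + t%:R / #|'Z_n|%:R <= q%:R.
  apply: le_trans cq; rewrite lerD2r lerD2l (le_trans (ler_norm _)) //.
  by rewrite (bigD1 i) //= lerDl sumr_ge0.
move=> /(_ c0)/le_trans; apply; rewrite mulrA.
by do 2![apply: ler_wpM2r; rewrite ?invr_ge0 ?sqr_ge0 //]; apply: ler_norm.
Qed.

End Words.

(** * Counting rewrites before an erasure *)

Section Erasure.
Variables (n : nat) (x : nat -> 'Z_n).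
Local Notation enc := (@self_randomized_encode n).

(** Levels never decrease, so the last check implies the earlier ones. At t = 0 nothing is checked,
    which matters when q = 0. *)
Lemma write_messagesE q t :
  isSome (write_messages enc q x t) =
    (t == 0%N) || [forall i, (block_state (mkseq x t) i < q)%N].
Proof.
suff : write_messages enc q x t =
    if (t == 0%N) || [forall i, (block_state (mkseq x t) i < q)%N]
    then Some (block_state (mkseq x t)) else None.
  by move=> ->; case: ifP.
elim: t => [|t IH] //=; rewrite IH mkseqS block_state_rcons.
set s := block_state _; case: ifP => //= tq.
case: ifP => // /forallP s_lt; case/negP: (negbT tq).
apply/orP; right; apply/forallP => i; apply: leq_ltn_trans (s_lt i).
by rewrite encode_cell leq_addr.
Qed.

Lemma isSome_write_messages_le q t t' : (t <= t')%N ->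
  isSome (write_messages enc q x t') -> isSome (write_messages enc q x t).
Proof.
move=> /subnKC <-; elim: (t' - t)%N => [|m IH]; first by rewrite addn0.
rewrite addnS /= => tm; apply: IH.
by case: (write_messages _ _ _ _) tm.
Qed.

(** The hypotheses make T the least natural number above b. The feasible times form an initial
    segment, so if T fails the supremum is at most T - 1 < b. *)
Lemma rewrites_before_erasure_ge (R : realType) q (b : R) T :
    b <= T%:R -> (forall t : nat, b <= t%:R -> (T <= t)%N) ->
  (b%:E <= rewrites_before_erasure R enc q x)%E =
    isSome (write_messages enc q x T).
Proof.
move=> bT Tmin; apply/idP/idP => [bN|wT]; last first.
  apply: (@le_trans _ _ T%:R%:E); first by rewrite lee_fin.
  by apply: ereal_sup_ubound; exists T.
apply: contraTT bN => wT; rewrite -ltNge.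
have T0 : (0 < T)%N by case: T wT {bT Tmin}.
apply: (@le_lt_trans _ _ T.-1%:R%:E).
  apply: ge_ereal_sup => _ [t wt <-]; rewrite lee_fin ler_nat -ltnS prednK //.
  by rewrite ltnNge; apply: contra wT => /isSome_write_messages_le; apply.
rewrite lte_fin ltNge; apply/negP => /Tmin.
by rewrite leqNgt prednK // leqnn.
Qed.

End Erasure.

(** * Independent messages *)
Section IidWords.
Variables (R : realType) (n : nat) (p : probability 'Z_n R).
Variables (d : measure_display) (Omega : measurableType d).
Variables (P : probability Omega R) (x : nat -> {RV P >-> 'Z_n}).
Hypothesis hx : iid p x.

Definition mass (a : 'Z_n) : R := fine (p [set a]).

Lemma measurable_message (A : set 'Z_n) : measurable A.
Proof. by []. Qed.

Lemma massE a : p [set a] = (mass a)%:E.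
Proof. by rewrite fineK // fin_num_measure. Qed.

Lemma mass_ge0 a : 0 <= mass a.
Proof. by rewrite fine_ge0. Qed.

Lemma mass_sum : \sum_a mass a = 1.
Proof.
apply: EFin_inj; rewrite -sumEFin; under eq_bigr do rewrite -massE.
rewrite -measure_bigsetU_ord //; last first.
  by move=> a b _ _ [c [-> ->]].
rewrite -(probability_setT p); congr (p _); apply/seteqP; split=> // a _.
by rewrite -bigcup_seq; exists a => //=; rewrite mem_index_enum.
Qed.

Definition word (t : nat) (om : Omega) : seq 'Z_n := mkseq (fun j => x j om) t.

(** Joint condition on the first t letters, separate conditions on the next m: a form stable under
    moving letter t from the word to the product. *)
Definition cylinder (B : pred (seq 'Z_n)) t m (A : nat -> set 'Z_n) :=
  [set om | B (word t om)] `&`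
  \big[setI/setT]_(t <= j < t + m) (x j @^-1` A j).

Lemma message_bigcapE t m A (b : 'Z_n) :
  \big[setI/setT]_(t <= j < t + m.+1)
      (x j @^-1` (if j == t then [set b] else A j)) =
    x t @^-1` [set b] `&`
    \big[setI/setT]_(t.+1 <= j < t.+1 + m) (x j @^-1` A j).
Proof.
rewrite big_ltn ?addnS ?addSn ?ltnS ?leq_addr // eqxx; congr (_ `&` _).
by apply: eq_big_nat => j /andP[tj _]; rewrite gtn_eqF.
Qed.

Lemma cylinder_split (B : pred (seq 'Z_n)) t m A :
  cylinder B t.+1 m A =
    \big[setU/set0]_(b : 'Z_n)
      cylinder (fun w => B (rcons w b)) t m.+1
        (fun j => if j == t then [set b] else A j).
Proof.
rewrite -bigcup_seq; apply/seteqP; split=> om.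
  case=> /= Bom Aom; exists (x t om) => /=; first by rewrite mem_index_enum.
  by move: Bom; rewrite /cylinder message_bigcapE /word mkseqS.
move=> [b _]; rewrite /cylinder message_bigcapE => -[/= Bom [/= xb Aom]].
by split=> //=; rewrite /word mkseqS xb.
Qed.

(** Induction on t, splitting on the value of letter t; at t = 0 only a product event is left, to
    which mutual independence applies. Measurability is carried along for additivity. *)
Lemma cylinder_prob (B : pred (seq 'Z_n)) t m A (a : nat -> R) :
    (forall j, p (A j) = (a j)%:E) ->
  measurable (cylinder B t m A) /\
  P (cylinder B t m A) =
    (word_mean mass t (fun w => (B w)%:R) * \prod_(t <= j < t + m) a j)%:E.
Proof.
elim: t m A a B => [|t IH] m A a B pA.
  rewrite /cylinder /= add0n.
  have -> : \big[setI/setT]_(0 <= j < m) (x j @^-1` A j) =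
      \bigcap_(j in [set` [fset j | j in iota 0 m]%fset]) (x j @^-1` A j).
    rewrite /index_iota subn0 -bigcap_seq.
    by congr (bigcap _ _); apply/seteqP; split=> j /=; rewrite !inE.
  have -> : [set om | B (word 0 om)] = if B [::] then setT else set0.
    by rewrite /word /=; case: (B _); apply/seteqP; split.
  split.
    apply: measurableI; first by case: (B _).
    by apply: fin_bigcap_measurable => // j _; apply: measurable_funPTI.
  case: (B _); last by rewrite set0I measure0 mul0r.
  rewrite setTI mul1r hx.1 //.
  rewrite -prodEFin /index_iota subn0.
  under eq_bigr => j _.
    have := hx.2 j (A j) (measurable_message _).
    rewrite /distribution /pushforward => ->.
    rewrite pA; over.
  apply: perm_big; apply: uniq_perm => [||j]; rewrite ?iota_uniq //.
  by rewrite !inE.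
pose F (b : 'Z_n) := cylinder (fun w => B (rcons w b)) t m.+1
  (fun j => if j == t then [set b] else A j).
have -> : cylinder B t.+1 m A = \big[setU/set0]_(b : 'Z_n) F b.
  exact: cylinder_split.
pose a' b j := if j == t then mass b else a j.
have FP b : measurable (F b) /\ P (F b) =
   (word_mean mass t (fun w => (B (rcons w b))%:R) *
     \prod_(t <= j < t + m.+1) a' b j)%:E.
  by apply: IH => j; rewrite /a'; case: eqP => // _; apply: massE.
split; first by apply: bigsetU_measurable => b _; case: (FP b).
rewrite measure_bigsetU_ord.
- rewrite (eq_bigr _ (fun b _ => (FP b).2)).
  rewrite sumEFin; congr (_%:E); rewrite /= word_mean_sum mulr_suml.
  apply: eq_bigr => b _; rewrite word_meanZ mulrAC [RHS]mulrC; congr (_ * _).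
  rewrite big_ltn ?addnS ?addSn ?ltnS ?leq_addr // {1}/a' eqxx; congr (_ * _).
  by apply: eq_big_nat => j /andP[tj _]; rewrite /a' gtn_eqF.
- by move=> b; case: (FP b).
- move=> b c _ _ [om []]; rewrite /F /cylinder !message_bigcapE.
  by move=> [_ [/= -> _]] [_ [/= -> _]].
Qed.

Lemma word_prob (B : pred (seq 'Z_n)) t :
  P [set om | B (word t om)] = (word_mean mass t (fun w => (B w)%:R))%:E.
Proof.
have [_] := @cylinder_prob B t 0 (fun=> setT) (fun=> 1)
  (fun=> probability_setT p).
by rewrite /cylinder addn0 !big_geq // setIT mulr1.
Qed.

Lemma rewrites_prob q (b : R) T :
    b <= T%:R -> (forall t : nat, b <= t%:R -> (T <= t)%N) ->
  P [set om | (b%:E <= rewrites_before_erasure R (@self_randomized_encode n) q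
      (fun t => x t om))%E] =
    (word_mean mass T (fun w =>
       ((T == 0%N) || [forall i, (block_state w i < q)%N])%:R))%:E.
Proof.
move=> bT Tmin; rewrite -word_prob; congr (P _); apply/seteqP.
split=> om /=; rewrite (rewrites_before_erasure_ge _ _ bT) //;
  by rewrite write_messagesE.
Qed.

Lemma with_high_probability_rewrites : #|'Z_n| = n ->
  with_high_probability_at_least P
    (fun q om => rewrites_before_erasure R (@self_randomized_encode n) q
      (fun t => x t om))
    (fun q => n%:R * (q%:R - q%:R `^ (2 / 3))).
Proof.
move=> cardZ.
have [K [G [K0 KG]]] := block_tail mass_ge0 mass_sum.
(* With y = q^(1/3) all the estimates become polynomial in y. *)
pose y (q : nat) : R := q%:R `^ 3^-1.
have y_ge0 q : 0 <= y q by apply: powR_ge0.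
have y3 q : q%:R = y q ^+ 3.
  by rewrite -powR_mulrn // -powRrM mulVf // powRr1.
have y2 q : q%:R `^ (2 / 3) = y q ^+ 2.
  by rewrite -powR_mulrn // -powRrM mulrC.
have y_oo : y q @[q --> \oo] --> +oo.
  apply/cvgryPge => A; near=> q; rewrite leNgt; apply/negP => yA.
  have : `|A| ^+ 3 <= q%:R by near: q; apply: nbhs_infty_ger.
  rewrite (y3 q) leNgt => /negP; apply.
  by rewrite ltrXn2r // (lt_le_trans yA) // ler_norm.
have n0 : 1 <= n%:R :> R by rewrite ler1n -cardZ card_ord.
(* The tail is K (T + 1) / c^2 with c = y^2 / 2, whence the 4, and T + 1 <= n y^3 + 2 <= (n + 2)
   y^3; the loss is at most L / y. *)
pose L := K * 4 * (n%:R + 2).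
rewrite /with_high_probability_at_least.
apply: (@squeeze_cvge _ _ _ _ (fun q => (1 - L * (y q)^-1)%:E) _ (fun=> 1%E)).
- near=> q.
  have y1 : 1 <= y q by near: q; move/cvgryPge: y_oo; apply.
  have y0 : 0 < y q by apply: lt_le_trans y1.
  (* With y >= 1 this gives G + 1 <= y^2 / 2: half of the gap y^2 pays for G and for rounding T up,
     the other half is the margin c. *)
  have yG : 2 * (G + 1) <= y q by near: q; move/cvgryPge: y_oo; apply.
  pose b := n%:R * (y q ^+ 3 - y q ^+ 2).
  have b0 : 0 <= b by rewrite mulr_ge0 // subr_ge0 ler_weXn2l.
  have ex_T : exists T : nat, b <= T%:R.
    by exists (Num.Def.archi_bound b); rewrite ltW // archi_boundP.
  case: (ex_minnP ex_T) => T bT Tmin.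
  have Tb : T%:R <= b + 1.
    case: (posnP T) => [->|T0]; first by rewrite addr_ge0.
    rewrite -(prednK T0) -natr1 lerD2r ltW // ltNge; apply/negP => /Tmin.
    by rewrite leqNgt prednK // leqnn.
  have -> : n%:R * (q%:R - q%:R `^ (2 / 3)) = b by rewrite y2 (y3 q).
  rewrite (rewrites_prob q bT Tmin); apply/andP; split; last first.
    rewrite lee_fin -[leRHS](word_mean_cst mass_sum T 1).
    apply: le_word_mean => [|w _]; first exact: mass_ge0.
    by rewrite (ler_nat _ _ 1) leq_b1.
  rewrite lee_fin.
  apply: (@le_trans _ _ (word_mean mass T (fun w =>
       [forall i, (block_state w i < q)%N]%:R))); last first.
    apply: le_word_mean => [|w _]; first exact: mass_ge0.
    by rewrite ler_nat; case: (T == 0%N); rewrite ?leq_b1.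
  have c0 : 0 < y q ^+ 2 / 2 by rewrite divr_gt0 // exprn_gt0.
  apply: le_trans (KG T q _ c0 _).
    rewrite lerD2l lerN2 ler_pdivrMr ?exprn_gt0 //.
    have -> : L * (y q)^-1 * (y q ^+ 2 / 2) ^+ 2 = K * ((n%:R + 2) * y q ^+ 3).
      by rewrite /L; field; rewrite gt_eqF.
    apply: ler_wpM2l => //; rewrite -natr1.
    have : 1 <= y q ^+ 3 by rewrite exprn_ege1.
    have : 0 <= n%:R * y q ^+ 2 by rewrite mulr_ge0 // exprn_ge0.
    by move: Tb; rewrite /b; lra.
  rewrite (y3 q) cardZ.
  have : T%:R / n%:R <= y q ^+ 3 - y q ^+ 2 + 1.
    rewrite ler_pdivrMr ?(lt_le_trans _ n0) //; apply: le_trans Tb _.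
    by rewrite mulrDl mul1r mulrC lerD2l.
  move: (T%:R / n%:R) => u; nra.
- rewrite -[X in _ --> X%:E]subr0.
  apply: cvg_EFin; first by near=> q.
  apply: cvgB; first exact: cvg_cst.
  rewrite -(mulr0 L); apply: cvgMr.
  apply/gtr0_cvgV0 => //; near=> q.
  by apply: (@lt_le_trans _ _ 1) => //; near: q; move/cvgryPge: y_oo; apply.
- exact: cvg_cst.
Unshelve. all: by end_near.
Qed.

End IidWords.

(** * Sublinearity of the deficit and conclusion *)

Lemma powR_littleo (R : realType) (a : R) : a < 1 ->
  (fun q : nat => q%:R `^ a : R^o) =o_\oo (fun q : nat => q%:R : R^o).
Proof.
move=> a1; apply/eqoP => e e0; near=> q.
have q0 : 0 < q%:R :> R by rewrite ltr0n; near: q; apply: nbhs_infty_gt.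
have a1' : 0 < 1 - a by rewrite subr_gt0.
(* Holds as soon as q >= (1/e)^(1/(1-a)); then q = q^(1-a) q^a absorbs the factor e. *)
have eq : 1 <= e * q%:R `^ (1 - a).
  rewrite -ler_pdivrMl // mulr1.
  have -> : e^-1 = (e^-1 `^ (1 - a)^-1) `^ (1 - a).
    by rewrite -powRrM mulVf ?gt_eqF // powRr1 // invr_ge0 ltW.
  apply: ge0_ler_powR; [exact: ltW|exact: powR_ge0|exact: ltW|].
  by near: q; apply: nbhs_infty_ger.
have qE : q%:R = q%:R `^ (1 - a) * q%:R `^ a :> R.
  by rewrite -powRD ?subrK ?powRr1 ?ltW // (gt_eqF q0) implybT.
rewrite !ger0_norm ?powR_ge0 // [X in _ <= _ * X]qE mulrA.
by rewrite ler_peMl // powR_ge0.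
Unshelve. all: by end_near.
Qed.

Theorem theorem1 (R : realType) (k l : nat) (hk : (1 <= k)%N) (hl : (2 <= l)%N)
    (p : probability 'Z_(l ^ k) R)
    (d : measure_display) (Omega : measurableType d) (P : probability Omega R)
    (x : nat -> {RV P >-> 'Z_(l ^ k)}) (hx : iid p x) :
  let n := (l ^ k)%N in
  let N (q : nat) (om : Omega) : \bar R :=
    rewrites_before_erasure R (@self_randomized_encode n) q
      (fun t => x t om) in
  with_high_probability_at_least P N
    (fun q => n%:R * (q%:R - q%:R `^ (2 / 3))) /\
  asymptotically_optimal P n N.
Proof.
move=> n N.
(* This needs l^k > 1, since ['Z_n] has two elements for n = 0 and n = 1. *)
have cardZ : #|'Z_n| = n.
  rewrite card_ord; apply: Zp_cast; rewrite /n.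
  by rewrite (leq_trans hl) // -{1}(expn1 l) leq_pexp2l // ltnW.
have whp := with_high_probability_rewrites hx cardZ.
split=> //; exists (fun q => q%:R `^ (2 / 3)); split=> //.
by apply: powR_littleo; lra.
Qed.
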